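(* Let $\alpha\in[0,1/2]$, $\Delta\ge0$, let $c'\in[0,1]$ be the constant with $f_\Delta(c')=\alpha$, and let $E^\star_\Delta$ be the estimator associated with $\varphi^\star_\Delta=\frac12\log\big(q^{+\star}_\Delta/q^{-\star}_\Delta\big)$. Then: (i) $E^\star_\Delta$ coincides with the Huber estimator $E^{\mathrm{huber}}_{\Delta,k}$ with $k=-\log(c')$ (where $k=+\infty$ if $c'=0$); that is, a function $E:\mathcal P\to\mathbb R$ is a $\varphi^\star_\Delta$-estimator if and only if it is a $\varphi^{\mathrm{huber}}_{\Delta,k}$-estimator. (ii) In particular, if $r>0$ and $\Delta>\Delta_{\mathrm{wc}}(r,\alpha)$, then for all $\theta^\star\in\mathbb R$ and all $\mathbb P^{c}\in\mathcal P$ with $\mathrm{TV}(\mathbb P^{c},\mathbb P_{\theta^\star})\le\alpha$, $$\limsup_{n\to\infty}\frac1n\log\mathrm{Prob}_{\mathbb P^{c}}\big(|E^\star_\Delta(\mathbb P_n)-\theta^\star|>\Delta\big)<-r .$$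
   Context: Setting. $\Xi=\Theta=\mathbb R$; $\mathcal P$ is the set of Borel probability distributions on $\mathbb R$. $g:\mathbb R\to(0,\infty)$ is a log-concave probability density, symmetric around the origin, and for $\theta\in\mathbb R$, $\mathbb P_\theta$ is the distribution with density $\xi\mapsto g(\xi-\theta)$. For $\mathbb P^{c}\in\mathcal P$, $\mathbb P_n$ is the empirical distribution of $n$ i.i.d. samples from $\mathbb P^{c}$ (estimators are assumed such that the displayed events are measurable). Divergences. $\mathrm{KL}(\mathbb P,\mathbb Q)=\int\log\frac{d\mathbb P}{d\mathbb Q}\,d\mathbb P$ if $\mathbb P\ll\mathbb Q$ and $+\infty$ otherwise; $\mathrm{TV}(\mathbb P,\mathbb Q)=\inf\{\epsilon>0:\mathbb Q(A)\le\mathbb P(A)+\epsilon,\ \mathbb P(A)\le\mathbb Q(A)+\epsilon\ \forall \text{ measurable }A\}$. DRO set and worst-case radius. $S_{r,\alpha}(\hat{\mathbb P})=\{\theta\in\mathbb R:\exists\,\mathbb Q\in\mathcal P,\ \mathrm{KL}(\hat{\mathbb P},\mathbb Q)\le r,\ \mathrm{TV}(\mathbb Q,\mathbb P_\theta)\le\alpha\}$. For nonempty $U\subseteq\mathbb R$, $\mathrm{radius}(U)=\inf_{s\in\mathbb R}\sup_{s'\in U}|s-s'|$ (half the diameter), and $\mathrm{radius}(\emptyset)=0$. $\Delta_{\mathrm{wc}}(r,\alpha)=\sup_{\hat{\mathbb P}\in\mathcal P}\mathrm{radius}(S_{r,\alpha}(\hat{\mathbb P}))$. $\varphi$-estimators.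 For an odd nondecreasing $\varphi:\mathbb R\to\mathbb R$, a $\varphi$-estimator is any function $E:\mathcal P\to\mathbb R$ with $\int\varphi(\xi-E(\hat{\mathbb P}))\,d\hat{\mathbb P}(\xi)=0$ for all $\hat{\mathbb P}\in\mathcal P$ (when $\varphi$ is unbounded, for all $\hat{\mathbb P}$ for which $\varphi(\cdot-t)$ is $\hat{\mathbb P}$-integrable for every $t\in\mathbb R$, in particular all empirical distributions). The Huber estimator $E^{\mathrm{huber}}_{\Delta,k}$ is the $\varphi$-estimator associated with $\varphi^{\mathrm{huber}}_{\Delta,k}(\xi)=\max\{-k,\min\{k,\log(g(\xi-\Delta)/g(\xi+\Delta))\}\}$. Least favorable densities. Let $c_\Delta(\xi)=g(\xi-\Delta)/g(\xi+\Delta)$ and $$f_\Delta(c)=\frac1{1+c}\int\big(c\,g(\xi+\Delta)-g(\xi-\Delta)\big)^+\,d\xi .$$ For the constant $c'\in[0,1]$ with $f_\Delta(c')=\alpha$ (with $1/c'=+\infty$ if $c'=0$), define $$q^{-\star}_\Delta(\xi)=\begin{cases}\frac{1}{1+c'}[g(\xi+\Delta)+g(\xi-\Delta)]& c_\Delta(\xi)\le c',\\ g(\xi+\Delta)& c'<c_\Delta(\xi)<1/c',\\ \frac{c'}{1+c'}[g(\xi+\Delta)+g(\xi-\Delta)]& c_\Delta(\xi)\ge 1/c',\end{cases}$$ $$q^{+\star}_\Delta(\xi)=\begin{cases}\frac{c'}{1+c'}[g(\xi+\Delta)+g(\xi-\Delta)]& c_\Delta(\xi)\le c',\\ g(\xi-\Delta)&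 c'<c_\Delta(\xi)<1/c',\\ \frac{1}{1+c'}[g(\xi+\Delta)+g(\xi-\Delta)]& c_\Delta(\xi)\ge 1/c'.\end{cases}$$ (If $c'=0$ only the middle case occurs; if several $c'$ satisfy the equation, which can happen only for $\alpha=0$, they give the same densities and any may be taken.) *)

(* Defs.v *)
From HB Require Import structures.
From mathcomp Require Import all_boot all_order all_algebra.
From mathcomp Require Import all_classical all_reals all_analysis.

Set Implicit Arguments.
Unset Strict Implicit.
Unset Printing Implicit Defensive.

Import Order.TTheory GRing.Theory Num.Theory.
Import numFieldNormedType.Exports.

Local Open Scope classical_set_scope.
Local Open Scope ring_scope.
Local Open Scope ereal_scope.

(* measurableTypeR R is R with the Borel sigma-algebra, on which lebesgue_measure
   lives. *)
Definition distributions (R : realType) := probability (measurableTypeR R) R.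

Section empirical.
Context {R : realType}.
Variables (x : nat -> R) (n : nat).

(* The sample is x 0, ..., x n: the size n.+1 is never zero, so that this is
   always a probability distribution. *)
Definition empirical : set (measurableTypeR R) -> \bar R :=
  mscale ((n.+1%:R^-1)%:nng)%R
    (msum (fun i => \d_(x i : measurableTypeR R)) n.+1).

HB.instance Definition _ := Measure.on empirical.

Lemma empirical_setT : empirical setT = 1.
Proof.
rewrite /empirical /mscale /= /msum.
rewrite (eq_bigr (fun=> 1%:E)) => [|i _]; last exact: diracT.
by rewrite sumEFin big_const_ord iter_addr addr0 -EFinM mulVf ?pnatr_eq0.
Qed.

HB.instance Definition _ := Measure_isProbability.Build _ _ _
  empirical empirical_setT.
End empirical.

Section divergences.
Context {R : realType}.

(* Since lne 0 = -oo and the negative part of log (dP/dQ) is P-integrable, the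
   extended integral is the usual one, with values in [0, +oo]. *)
Definition KL (P Q : distributions R) : \bar R :=
  if `[< P `<< Q >] then
    \int[P]_x lne (Radon_Nikodym (charge_of_finite_measure P) Q x)
  else +oo.

Definition TV (P Q : set (measurableTypeR R) -> \bar R) : \bar R :=
  ereal_inf [set e%:E | e in [set e : R | (0 < e)%R /\
    forall A, measurable A -> Q A <= P A + e%:E /\ P A <= Q A + e%:E]].
End divergences.

Section location_family.
Context {R : realType}.
Implicit Types g : R -> R.

Definition log_concave g : Prop :=
  convex_function [set: R^o] (fun x => - ln (g x) : R^o)%R.

Definition probability_density g : Prop :=
  [/\ measurable_fun [set: measurableTypeR R] g, forall x, (0 <= g x)%R &
      \int[lebesgue_measure]_x (g x)%:E = 1].

Definition location g (theta : R) : set (measurableTypeR R) -> \bar R :=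
  fun A => \int[lebesgue_measure]_(xi in A) (g (xi - theta)%R)%:E.

Definition lratio g (Delta xi : R) : R := (g (xi - Delta) / g (xi + Delta))%R.
End location_family.

Section worst_case_radius.
Context {R : realType}.

Definition dro_set (g : R -> R) (r alpha : R) (Phat : distributions R) : set R :=
  [set theta | exists Q : distributions R,
    KL Phat Q <= r%:E /\ TV Q (location g theta) <= alpha%:E].

(* The empty set is apart because ereal_sup set0 = -oo. *)
Definition set_radius (U : set R) : \bar R :=
  if `[< U = set0 >] then 0 else
  ereal_inf [set ereal_sup [set `|s - s'|%:E | s' in U] | s in [set: R]].

Definition Delta_wc (g : R -> R) (r alpha : R) : \bar R :=
  ereal_sup [set set_radius (dro_set g r alpha Phat) |
    Phat in [set: distributions R]].
End worst_case_radius.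

Section estimators.
Context {R : realType}.
Implicit Types (phi : R -> R) (E : distributions R -> R).

Definition phi_admissible phi (P : distributions R) : Prop :=
  (exists M, forall x, (`|phi x| <= M)%R) \/
  (forall t : R, P.-integrable [set: measurableTypeR R] (fun xi => (phi (xi - t)%R)%:E)).

Definition phi_estimator phi E : Prop :=
  forall P, phi_admissible phi P -> \int[P]_xi (phi (xi - E P)%R)%:E = 0.

(* For 0 <= k the extended real inside fine is finite, even when k = +oo. *)
Definition huber_phi (g : R -> R) (Delta : R) (k : \bar R) (xi : R) : R :=
  fine (maxe (- k) (mine k (ln (lratio g Delta xi))%:E)).
End estimators.

Section least_favorable.
Context {R : realType}.
Variables (g : R -> R) (Delta : R).

Definition f_Delta (c : R) : \bar R :=
  ((1 + c)^-1)%R%:E *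
  \int[lebesgue_measure]_xi
    (Num.max (c * g (xi + Delta) - g (xi - Delta)) 0)%R%:E.

(* The threshold 1/c' is taken in the extended reals, where 0^-1 = +oo. *)
Definition qminus (c' : R) (xi : R) : R :=
  (if lratio g Delta xi <= c' then (g (xi + Delta) + g (xi - Delta)) / (1 + c')
   else if ((lratio g Delta xi)%:E < c'%:E^-1)%E then g (xi + Delta)
   else c' / (1 + c') * (g (xi + Delta) + g (xi - Delta)))%R.

Definition qplus (c' : R) (xi : R) : R :=
  (if lratio g Delta xi <= c' then c' / (1 + c') * (g (xi + Delta) + g (xi - Delta))
   else if ((lratio g Delta xi)%:E < c'%:E^-1)%E then g (xi - Delta)
   else (g (xi + Delta) + g (xi - Delta)) / (1 + c'))%R.

Definition phi_star (c' : R) (xi : R) : R :=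
  (2^-1 * ln (qplus c' xi / qminus c' xi))%R.
End least_favorable.

Section iid.
Context d {Omega : measurableType d} {R : realType}.
Variables (Pr : probability Omega R) (X : nat -> {RV Pr >-> measurableTypeR R}).

Definition mutually_independent : Prop :=
  forall (J : seq nat) (A : nat -> set (measurableTypeR R)), uniq J ->
    (forall i, measurable (A i)) ->
    Pr (\bigcap_(i in [set` J]) (X i @^-1` A i)) =
    \prod_(i <- J) Pr (X i @^-1` A i).

Definition iid (P : distributions R) : Prop :=
  mutually_independent /\
  forall i A, measurable A -> distribution Pr (X i) A = P A.
End iid.

(* Main.v *)
Require Import Defs.
From HB Require Import structures.
From mathcomp Require Import all_boot all_order all_algebra.
From mathcomp Require Import all_classical all_reals all_analysis.
From mathcomp Require Import unstable measurable_realfun ring lra.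

(** Write q+ and q- for the two least favorable densities, phi = 1/2 log (q+/q-)
    and rho = int sqrt (q+ q-).

    Comparing the three cases in the definition of q+ and q- shows that phi is
    one half of the Huber function (phi_star_huber), and a nonzero factor does
    not change the estimating equation (phi_estimatorZ). This is the first part.

    For the second part, phi is nondecreasing because g is log-concave, so an
    estimate above thetas + Delta forces the sum of phi (X_i - thetas - Delta) to
    be nonnegative, and one below thetas - Delta forces the sum of
    phi (X_i - thetas + Delta) to be nonpositive. By the Chernoff bound for
    independent samples (chernoff_iid) the first event has probability at most
    the n-th power of the expectation of exp phi (X - thetas - Delta), and the
    second at most that of exp (- phi (X - thetas + Delta)). Both expectations
    are at most rho on the whole total variation ball (moment_phi_star_right,
    moment_phi_star_left). Indeed, call nominal the law with density
    g (x + Delta). From it to a law at distance alpha, the expectation of exp phi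
    grows by at most alpha times the oscillation of exp phi
    (le_integral_total_variation), and q- attains this growth, since it moves a
    mass alpha from the points where phi is smallest to those where it is
    largest; finally int exp phi q- = rho. When c' = 0 the oscillation may be
    infinite, but then alpha = 0 and the ball is reduced to its center. Hence the
    error probability is at most 2 rho ^ n.

    It remains to see that log rho < - r (le_Delta_wc). Otherwise the law P with
    density sqrt (q+ q-) / rho is such that KL (P, q-) = KL (P, q+) = - log rho
    is at most r: the logarithms of the density ratios are phi - log rho and
    - phi - log rho, and phi is odd while P is symmetric. As q- and q+ are within
    alpha of the laws of parameters - Delta and Delta, both parameters belong to
    the robust set of P, whose radius is then at least Delta, against
    Delta_wc < Delta. *)

Set Implicit Arguments.
Unset Strict Implicit.
Unset Printing Implicit Defensive.

Import Order.TTheory GRing.Theory Num.Theory.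
Import numFieldNormedType.Exports.

Local Open Scope classical_set_scope.
Local Open Scope ring_scope.

(** * Measures with a density *)

Section density_measure.
Local Open Scope ereal_scope.
Context d (T : measurableType d) (R : realType).
Variables (mu : {measure set T -> \bar R}) (f : T -> R).

(** The proofs are arguments so that the measure structure can be inferred from
    the term. *)
Definition density (mf : measurable_fun [set: T] f)
    (f0 : forall x, (0 <= f x)%R) : set T -> \bar R :=
  fun A => \int[mu]_(x in A) (f x)%:E.

Hypotheses (mf : measurable_fun [set: T] f) (f0 : forall x, (0 <= f x)%R).
Local Notation nu := (density mf f0).

Let density_set0 : nu set0 = 0. Proof. exact: integral_set0. Qed.

Let density_ge0 A : 0 <= nu A.
Proof. by apply: integral_ge0 => x _; rewrite lee_fin. Qed.

Let density_semi_sigma_additive : semi_sigma_additive nu.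
Proof.
apply: semi_sigma_additive_nng_induced => [|x]; last by rewrite lee_fin.
exact/measurable_EFinP.
Qed.

HB.instance Definition _ := isMeasure.Build _ _ _ nu
  density_set0 density_ge0 density_semi_sigma_additive.

Let integral_density_indic (A : set T) : measurable A ->
  \int[nu]_x (\1_A x)%:E = \int[mu]_x ((\1_A x)%:E * (f x)%:E).
Proof.
move=> mA; rewrite integral_indic// setIT [LHS]integral_mkcond.
by apply: eq_integral => x _; rewrite epatch_indic/= muleC.
Qed.

Import HBNNSimple.

Let integral_density_nnsfun (h : {nnsfun T >-> R}) :
  \int[nu]_x (h x)%:E = \int[mu]_x ((h x)%:E * (f x)%:E).
Proof.
have mh (r : R) : measurable (h @^-1` [set r]) by exact: measurable_funPTI.
pose F (r : R) (x : T) := (r * \1_(h @^-1` [set r]) x)%:E.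
have mF r : measurable_fun [set: T] (F r).
  by apply/measurable_EFinP; exact: measurable_funM.
have F0 r x : 0 <= F r x by exact: nnfun_muleindic_ge0.
have hE x : (h x)%:E = \sum_(r \in range h) F r x.
  by rewrite {1}fimfunE -fsumEFin.
have mf' : measurable_fun [set: T] (EFin \o f) by exact/measurable_EFinP.
transitivity (\int[nu]_x (\sum_(r \in range h) F r x)).
  by apply: eq_integral => x _; exact: hE.
transitivity (\int[mu]_x (\sum_(r \in range h) F r x * (f x)%:E)); last first.
  by apply: eq_integral => x _; rewrite hE ge0_mule_fsuml.
rewrite !ge0_integral_fsum//; first last.
- by move=> r x _; rewrite mule_ge0// lee_fin.
- by move=> r; exact: emeasurable_funM.
apply: eq_fsbigr => r; rewrite inE => -[t _ <-].
rewrite integralZl_indic_nnsfun// integral_density_indic//.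
rewrite -ge0_integralZl//.
- by apply: eq_integral => x _; rewrite /F EFinM muleA.
- by apply: emeasurable_funM => //; exact/measurable_EFinP.
- by move=> x _; rewrite mule_ge0// lee_fin.
- by rewrite lee_fin.
Qed.

(** Both sides are monotone limits along simple functions, for which the
    identity is the definition of the measure. *)
Lemma ge0_integral_density (h : T -> \bar R) :
  measurable_fun [set: T] h -> (forall x, 0 <= h x) ->
  \int[nu]_x h x = \int[mu]_x (h x * (f x)%:E).
Proof.
move=> mh h0; pose h_ := nnsfun_approx measurableT mh.
have h_cvg x : (EFin \o h_^~ x) @ \oo --> h x by exact: cvg_nnsfun_approx.
have h_nd x n m : (n <= m)%N -> (h_ n x <= h_ m x)%R.
  by move=> nm; exact/lefP/nd_nnsfun_approx.
have mh_ n : measurable_fun [set: T] (fun x => (h_ n x)%:E).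
  exact/measurable_EFinP.
transitivity (limn (fun n => \int[nu]_x (h_ n x)%:E)).
  rewrite -monotone_convergence//.
  - by apply: eq_integral => x _; apply/esym/cvg_lim => //; exact: h_cvg.
  - by move=> n x _; rewrite lee_fin.
  - by move=> x _ n m nm; rewrite lee_fin h_nd.
transitivity (limn (fun n => \int[mu]_x ((h_ n x)%:E * (f x)%:E))).
  by congr (limn _); apply/funext => n; exact: integral_density_nnsfun.
rewrite -monotone_convergence//.
- by apply: eq_integral => x _; apply/cvg_lim => //; apply: cvgeZr => //; exact: h_cvg.
- by move=> n; apply: emeasurable_funM => //; exact/measurable_EFinP.
- by move=> n x _; rewrite mule_ge0// lee_fin.
- by move=> x _ n m nm; rewrite lee_wpmul2r ?lee_fin// h_nd.
Qed.
End density_measure.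

(** * Symmetries of the Lebesgue measure *)

Section lebesgue_invariance.
Local Open Scope ereal_scope.
Context (R : realType).
Let mu := @lebesgue_measure R.
Implicit Types (F : R -> \bar R).

Lemma ge0_integral_lebesgueN F : measurable_fun [set: measurableTypeR R] F ->
  (forall x, 0 <= F x) -> \int[mu]_x F (- x)%R = \int[mu]_x F x.
Proof.
move=> mF F0.
have mN : measurable_fun [set: measurableTypeR R]
  (-%R : _ -> measurableTypeR R) by exact: measurable_funN.
rewrite -[LHS](ge0_integral_pushforward mN mu measurableT)//.
by apply: eq_measure_integral => A mA _; exact: lebesgue_measureN.
Qed.

Lemma ge0_integral_lebesgueB F t : measurable_fun [set: measurableTypeR R] F ->
  (forall x, 0 <= F x) -> \int[mu]_x F (x - t)%R = \int[mu]_x F x.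
Proof.
move=> mF F0.
have mB : measurable_fun [set: measurableTypeR R]
  ((fun x => x - t)%R : _ -> measurableTypeR R) by exact: measurable_funB.
rewrite -[LHS](ge0_integral_pushforward mB mu measurableT)//.
apply: eq_measure_integral => A mA _; apply/esym.
apply: (lebesgue_measure_unique _ mA) => /= _ [[a b]] _ <-.
rewrite /pushforward/= (_ : _ @^-1` _ = `](a + t)%R, (b + t)%R]%classic).
  rewrite /mu !lebesgue_measure_itv/= !lte_fin ltrD2r.
  by rewrite -!EFinB opprD addrACA subrr addr0.
by apply/seteqP; split => x /=; rewrite !in_itv/= ltrBrDr lerBlDr.
Qed.
End lebesgue_invariance.

(** * Expectations under laws that are close in total variation *)

Section total_variation.
Local Open Scope ereal_scope.
Context d (T : measurableType d) (R : realType).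
Variables (P Q : probability T R).

(** Layer cake: the integral of H - a is the integral of its tail over
    [0, b - a], and the two tails differ by at most alpha. *)
Lemma le_integral_total_variation (H : T -> R) (a b alpha : R) :
  measurable_fun [set: T] H -> (0 <= a)%R -> (forall x, a <= H x <= b)%R ->
  (0 <= alpha)%R -> (forall A, measurable A -> P A <= Q A + alpha%:E) ->
  \int[P]_x (H x)%:E <= \int[Q]_x (H x)%:E + (alpha * (b - a))%:E.
Proof.
move=> mH a0 Hab alpha0 PQ.
have ab : (0 <= b - a)%R.
  case/andP: (Hab point) => aH Hb; rewrite subr_ge0; exact: le_trans Hb.
have mHa : measurable_fun [set: T] (fun x => H x - a)%R.
  exact: measurable_funB.
pose mix := isMeasurableFun.Build _ _ _ _ _ mHa.
pose X : {mfun T >-> R} := HB.pack (fun x => H x - a)%R mix.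
have X0 x : (0 <= X x)%R by rewrite subr_ge0; case/andP: (Hab x).
have int_shift (M : probability T R) :
    \int[M]_x (H x)%:E = 'E_M[X] + a%:E.
  rewrite expectation_def -[X in _ + X]mule1 -(probability_setT M).
  rewrite -integral_cst// -ge0_integralD//.
  - by apply: eq_integral => x _; rewrite -EFinD subrK.
  - by move=> x _; rewrite lee_fin.
  - exact/measurable_EFinP.
rewrite !int_shift addeAC leeD2r//.
rewrite (ge0_expectation_ccdf (X := X : {RV P >-> R}) X0).
rewrite (ge0_expectation_ccdf (X := X : {RV Q >-> R}) X0).
pose D : set R := `[0%R, (b - a)%R]%classic.
have mD : measurable D by exact: measurable_itv.
rewrite (_ : (alpha * (b - a))%:E =
    \int[lebesgue_measure]_(r in `[0%R, +oo[) (alpha * \1_D r)%:E); last first.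
  under eq_integral do rewrite EFinM.
  rewrite ge0_integralZl//; last exact/measurable_EFinP/measurable_indic.
  rewrite integral_indic// setIidl.
    rewrite /D /= lebesgue_measure_itv/= lte_fin.
    case: ltP => [_|ba]; first by rewrite sube0 EFinM.
    by rewrite (le_anti (introT andP (conj ba ab))) !mulr0 mule0.
  by move=> r; rewrite /D/= !in_itv/= andbT => /andP[].
rewrite -ge0_integralD//.
- apply: ge0_le_integral => //.
  + by apply: measurable_funTS; exact: ccdf_measurable.
  + apply: emeasurable_funD; first by apply: measurable_funTS; exact: ccdf_measurable.
    by apply/measurable_EFinP/measurable_funM => //; exact: measurable_indic.
  + move=> r; rewrite /= in_itv/= andbT => r0.
    have mr : measurable (X @^-1` `]r, +oo[).
      by apply: measurable_funPTI; exact: measurable_itv.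
    have [rb|br] := leP r (b - a)%R.
      rewrite indicE mem_set ?mulr1; last by rewrite /D/= in_itv/= r0.
      exact: PQ.
    rewrite [X in X <= _](_ : _ = 0) ?adde_ge0 ?lee_fin ?mulr_ge0//.
    rewrite /ccdf /distribution /pushforward [X in P X](_ : _ = set0)//.
    apply/seteqP; split => x //=; rewrite in_itv/= andbT => rX.
    have := lt_trans br rX; rewrite ltrD2r ltNge => /negP; apply.
    by case/andP: (Hab x).
- by apply: measurable_funTS; exact: ccdf_measurable.
- by move=> r _; rewrite lee_fin mulr_ge0.
- by apply/measurable_EFinP/measurable_funM => //; exact: measurable_indic.
Qed.
End total_variation.

(** * Products of independent variables *)

Section independent_product.
Local Open Scope ereal_scope.
Context d (Omega : measurableType d) (R : realType).
Variables (Pr : probability Omega R).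
Variable X : nat -> {RV Pr >-> measurableTypeR R}.
Hypothesis X_indep : mutually_independent X.

Let cylinder (t : seq nat) (A : nat -> set (measurableTypeR R)) :=
  \bigcap_(i in [set` t]) (X i @^-1` A i).

Let measurable_cylinder t A : (forall i, measurable (A i)) ->
  measurable (cylinder t A).
Proof.
move=> mA; rewrite /cylinder bigcap_seq; apply: bigsetI_measurable => i _.
exact: measurable_funPTI.
Qed.

(** One factor at a time: as functions of the set to which X k is confined, both
    sides of the product rule are measures on the line, and equal measures give
    the same integral to f k. *)
Let integral_prod_cylinder (f : nat -> R -> R) (s : seq nat) :
  (forall i, measurable_fun [set: measurableTypeR R] (f i)) ->
  (forall i x, (0 <= f i x)%R) ->
  (forall i, \int[Pr]_w (f i (X i w))%:E < +oo) ->
  forall t A, uniq (s ++ t) -> (forall i, measurable (A i)) ->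
  \int[Pr]_w (\prod_(i <- s) f i (X i w) * \1_(cylinder t A) w)%:E =
  (\prod_(i <- s) \int[Pr]_w (f i (X i w))%:E) * Pr (cylinder t A).
Proof.
move=> mf f0 foo.
have mfX i : measurable_fun [set: Omega] (fun w => f i (X i w)).
  exact: measurableT_comp.
have int_ge0 i : 0 <= \int[Pr]_w (f i (X i w))%:E.
  by apply: integral_ge0 => w _; rewrite lee_fin.
elim: s => [|k s IH] t A /= st mA.
  rewrite !big_nil mul1e; under eq_integral do rewrite big_nil mul1r.
  by rewrite integral_indic ?setIT//; exact: measurable_cylinder.
move: st => /andP[kst st].
have kt : k \notin t by apply: contra kst; rewrite mem_cat orbC => ->.
pose D w := (\prod_(i <- s) f i (X i w) * \1_(cylinder t A) w)%R.
have mC := measurable_cylinder t mA.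
have mD : measurable_fun [set: Omega] D.
  apply: measurable_funM; last exact: measurable_indic.
  by apply: measurable_prod => i _.
have D0 w : (0 <= D w)%R by rewrite mulr_ge0 ?prodr_ge0.
pose c := (\prod_(i <- s) \int[Pr]_w (f i (X i w))%:E) * Pr (cylinder t A).
have c_fin : c \is a fin_num.
  rewrite fin_numM ?fin_num_measure// prode_fin_num// => i _.
  by rewrite ge0_fin_numE.
have c0 : 0 <= c by rewrite mule_ge0// prode_ge0.
pose nu1 := pushforward (density Pr mD D0) (X k).
pose nu2 := pushforward
  (density Pr (measurable_cst (fine c)) (fun=> fine_ge0 c0)) (X k).
have nu12 B : measurable B -> nu1 B = nu2 B.
  move=> mB; rewrite /nu1 /nu2 /pushforward /density.
  have mXB : measurable (X k @^-1` B) by exact: measurable_funPTI.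
  rewrite [RHS](_ : _ = c * Pr (X k @^-1` B)); last first.
    by rewrite -[in RHS](fineK c_fin) -integral_cst.
  rewrite integral_mkcond.
  pose A' i := if i == k then B else A i.
  have mA' i : measurable (A' i) by rewrite /A'; case: ifP.
  have cA' : cylinder t A' = cylinder t A.
    apply: eq_bigcapr => i /= it; rewrite /A' ifN//.
    by apply: contraNneq kt => <-.
  have kA' : cylinder (k :: t) A' = X k @^-1` B `&` cylinder t A.
    by rewrite -cA' /cylinder !bigcap_seq big_cons /A' eqxx.
  transitivity (\int[Pr]_w
      (\prod_(i <- s) f i (X i w) * \1_(cylinder (k :: t) A') w)%:E).
    apply: eq_integral => w _; rewrite epatch_indic/= -EFinM -mulrA.
    by rewrite kA' indicI/= [(\1_(_ @^-1` _) w * _)%R]mulrC.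
  rewrite IH//; last by rewrite -[k :: t]/([:: k] ++ t) uniq_catCA /= kst.
  rewrite /c -muleA; congr (_ * _).
  rewrite /cylinder X_indep//; last by rewrite /= kt; move: st; rewrite cat_uniq => /and3P[].
  rewrite big_cons {1}/A' eqxx muleC; congr (_ * _).
  rewrite -X_indep// -?/(cylinder _ _) ?cA'//.
  by move: st; rewrite cat_uniq => /and3P[].
have nuE : \int[nu1]_x (f k x)%:E = \int[nu2]_x (f k x)%:E.
  by apply: eq_measure_integral => B mB _; exact: nu12.
have mfk : measurable_fun [set: measurableTypeR R] (EFin \o f k).
  exact/measurable_EFinP.
move: nuE; rewrite !ge0_integral_pushforward//; last 2 first.
- by move=> x _; rewrite lee_fin.
- by move=> x _; rewrite lee_fin.
rewrite !preimage_setT !ge0_integral_density//; last 4 first.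
- exact/measurable_EFinP.
- by move=> w; rewrite lee_fin.
- exact/measurable_EFinP.
- by move=> w; rewrite lee_fin.
rewrite big_cons => nuE.
transitivity (\int[Pr]_w ((EFin \o f k \o X k) w * (D w)%:E)).
  by apply: eq_integral => w _; rewrite big_cons /= -EFinM mulrA.
rewrite nuE /= ge0_integralZr//; last 3 first.
- exact/measurable_EFinP.
- by move=> w _; rewrite lee_fin.
- by rewrite fineK.
by rewrite fineK// /c muleA.
Qed.

Lemma integral_prod_independent (f : nat -> R -> R) (s : seq nat) :
  (forall i, measurable_fun [set: measurableTypeR R] (f i)) ->
  (forall i x, (0 <= f i x)%R) ->
  (forall i, \int[Pr]_w (f i (X i w))%:E < +oo) -> uniq s ->
  \int[Pr]_w (\prod_(i <- s) f i (X i w))%:E =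
  \prod_(i <- s) \int[Pr]_w (f i (X i w))%:E.
Proof.
move=> mf f0 foo us.
have := @integral_prod_cylinder f s mf f0 foo [::] (fun=> setT).
rewrite cats0 /cylinder => /(_ us (fun=> measurableT)).
rewrite bigcap_seq big_nil probability_setT mule1 => <-.
by apply: eq_integral => w _; rewrite indicT mulr1.
Qed.
End independent_product.

(** * Chernoff bound for samples *)

Section iid_sums.
Local Open Scope ereal_scope.
Context d (Omega : measurableType d) (R : realType).
Variables (Pr : probability Omega R).
Variable X : nat -> {RV Pr >-> measurableTypeR R}.
Variable P : distributions R.

Lemma ge0_integral_iid (f : R -> \bar R) (i : nat) : iid X P ->
  measurable_fun [set: measurableTypeR R] f -> (forall x, 0 <= f x) ->
  \int[Pr]_w f (X i w) = \int[P]_x f x.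
Proof.
move=> [_ XP] mf f0; rewrite -[LHS](ge0_integral_distribution (X i) mf)//.
by apply: eq_measure_integral => A mA _; exact: XP.
Qed.

Lemma measurable_sum_ge0 (psi : R -> R) (n : nat) :
  measurable_fun [set: measurableTypeR R] psi ->
  measurable [set w | (0 <= \sum_(0 <= i < n) psi (X i w))%R].
Proof.
move=> mpsi.
have mS : measurable_fun [set: Omega] (fun w => \sum_(0 <= i < n) psi (X i w))%R.
  by apply: measurable_sum => i; exact: measurableT_comp.
rewrite -[X in measurable X]setTI.
have := mS measurableT `[0%R, +oo[%classic (measurable_itv _).
by congr (measurable (_ `&` _)); apply/seteqP; split => w /=;
  rewrite in_itv/= andbT.
Qed.

(** The indicator of a nonnegative sum is at most the exponential of the sum,
    whose expectation factors by independence. *)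
Lemma chernoff_iid (psi : R -> R) (rho : R) (n : nat) : iid X P ->
  measurable_fun [set: measurableTypeR R] psi ->
  \int[P]_x (expR (psi x))%:E <= rho%:E ->
  Pr [set w | (0 <= \sum_(0 <= i < n) psi (X i w))%R] <= (rho ^+ n)%:E.
Proof.
move=> XP mpsi psi_rho.
have me : measurable_fun [set: measurableTypeR R] (fun x => expR (psi x)).
  exact: measurableT_comp.
set A := [set w | _].
have mA : measurable A by exact: measurable_sum_ge0.
have int_e i : \int[Pr]_w (expR (psi (X i w)))%:E = \int[P]_x (expR (psi x))%:E.
  rewrite (ge0_integral_iid (f := fun x => (expR (psi x))%:E) i XP)//.
  exact/measurable_EFinP.
have -> : Pr A = \int[Pr]_w (\1_A w)%:E by rewrite integral_indic// setIT.
apply: (@le_trans _ _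
    (\int[Pr]_w (\prod_(i <- index_iota 0 n) expR (psi (X i w)))%:E)).
  apply: ge0_le_integral => //.
  - exact/measurable_EFinP/measurable_indic.
  - apply/measurable_EFinP/measurable_prod => i _.
    by apply: (measurableT_comp me).
  - move=> w _; rewrite lee_fin -expR_sum indicE.
    have [wA|wA] := boolP (w \in A); last exact: expR_ge0.
    by rewrite -expR0 ler_expR; move: wA; rewrite inE.
have e0 : 0 <= \int[P]_x (expR (psi x))%:E.
  by apply: integral_ge0 => x _; rewrite lee_fin expR_ge0.
have e_fin : \int[P]_x (expR (psi x))%:E \is a fin_num.
  by rewrite ge0_fin_numE// (le_lt_trans psi_rho)// ltry.
have e_lty i : \int[Pr]_w (expR (psi (X i w)))%:E < +oo.
  by rewrite int_e -ge0_fin_numE.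
rewrite (integral_prod_independent (proj1 XP) (f := fun _ x => expR (psi x)) _ _
  e_lty (iota_uniq _ _))//.
rewrite (eq_bigr (fun=> (fine (\int[P]_x (expR (psi x))%:E))%:E)); last first.
  by move=> i _; rewrite int_e fineK.
rewrite big_const_seq count_predT size_iota subn0 iter_mule mule1.
rewrite -EFin_expe lee_fin lerXn2r ?nnegrE ?fine_ge0//.
  by rewrite -lee_fin (le_trans e0).
by rewrite -lee_fin fineK.
Qed.
End iid_sums.

(** * Integrals against empirical distributions *)

Section empirical_integral.
Local Open Scope ereal_scope.
Context (R : realType) (x : nat -> R) (n : nat).

Lemma ge0_integral_empirical (F : R -> \bar R) :
  measurable_fun [set: measurableTypeR R] F -> (forall y, 0 <= F y) ->
  \int[empirical x n]_y F y = (n.+1%:R^-1)%:E * \sum_(i < n.+1) F (x i).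
Proof.
move=> mF F0; rewrite /empirical ge0_integral_mscale//; congr (_ * _).
rewrite ge0_integral_measure_sum//; apply: eq_bigr => i _.
by rewrite integral_dirac// diracT mul1e.
Qed.

Lemma integrable_empirical (F : R -> R) :
  measurable_fun [set: measurableTypeR R] F ->
  (empirical x n).-integrable [set: measurableTypeR R] (EFin \o F).
Proof.
move=> mF; apply/integrableP; split; first exact/measurable_EFinP.
rewrite ge0_integral_empirical//; last first.
  by apply: measurableT_comp => //; exact/measurable_EFinP.
by rewrite /= sumEFin -EFinM ltry.
Qed.

Lemma integral_empirical (F : R -> R) :
  measurable_fun [set: measurableTypeR R] F ->
  \int[empirical x n]_y (F y)%:E =
  (n.+1%:R^-1 * \sum_(i < n.+1) F (x i))%:E.
Proof.
move=> mF.
have mF' : measurable_fun [set: measurableTypeR R] (EFin \o F).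
  exact/measurable_EFinP.
have mp := measurable_funepos mF'; have mn := measurable_funeneg mF'.
rewrite integralE !ge0_integral_empirical//.
have -> : \sum_(i < n.+1) (EFin \o F)^\+ (x i) =
    (\sum_(i < n.+1) Num.max (F (x i)) 0)%:E.
  by rewrite -sumEFin; apply: eq_bigr => i _; rewrite funeposE EFin_max.
have -> : \sum_(i < n.+1) (EFin \o F)^\- (x i) =
    (\sum_(i < n.+1) Num.max (- F (x i)) 0)%:E.
  by rewrite -sumEFin; apply: eq_bigr => i _; rewrite funenegE EFin_max.
rewrite -!EFinM -EFinB -mulrBr -sumrB; congr (_ * _)%:E.
by apply: eq_bigr => i _; rewrite !maxEle; do 2 case: ifP; lra.
Qed.
End empirical_integral.

(** * Exponential rates *)

Section exponential_rate.
Local Open Scope ereal_scope.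
Context (R : realType).

Lemma limn_esup_le (u v : (\bar R)^nat) : (forall n, u n <= v n) ->
  limn_esup u <= limn_esup v.
Proof.
move=> uv; rewrite !limn_esup_lim; apply: lee_lim.
- exact: is_cvg_esups.
- exact: is_cvg_esups.
- apply: nearW => n; apply: ge_ereal_sup => _ [m nm <-].
  by apply: (le_trans (uv m)); apply: ereal_sup_ubound; exists m.
Qed.

(** The factor C contributes ln C / n, which vanishes in the limit. *)
Lemma limn_esup_rate_le (p : (\bar R)^nat) (C rho : R) :
  (0 < C)%R -> (0 < rho)%R ->
  (forall n, 0 <= p n <= (C * rho ^+ n.+1)%:E) ->
  limn_esup (fun n => (n.+1%:R^-1)%:E * lne (p n)) <= (ln rho)%:E.
Proof.
move=> C0 rho0 pC.
pose v n : \bar R := (n.+1%:R^-1 * ln C + ln rho)%:E.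
have v_cvg : v @ \oo --> (ln rho)%:E.
  apply: cvg_EFin; first exact: nearW.
  rewrite -[X in _ --> X]add0r; apply: cvgD; last exact: cvg_cst.
  rewrite -(mul0r (ln C)); apply: cvgMl; exact: cvg_harmonic.
apply: le_trans (_ : limn_esup v <= _); last first.
  by rewrite is_cvg_limn_esupE ?(cvg_lim _ v_cvg)//; apply/cvg_ex; exists (ln rho)%:E.
apply: limn_esup_le => n; have /andP[pn0 pn] := pC n.
have c0 : (0 < C * rho ^+ n.+1)%R by rewrite mulr_gt0// exprn_gt0.
apply: (@le_trans _ _ ((n.+1%:R^-1)%:E * lne (C * rho ^+ n.+1)%:E)).
  rewrite lee_wpmul2l ?lee_fin//.
  by rewrite lee_lne// in_itv/= ?leey ?andbT// lee_fin ltW.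
rewrite lne_EFin// -EFinM lee_fin lnM ?posrE// ?exprn_gt0// lnXn//.
by rewrite mulrDr lerD2l -[(ln rho *+ _)%R]mulr_natl mulrA mulVf ?mul1r// pnatr_eq0.
Qed.
End exponential_rate.

(** * Divergences between laws with densities *)

Section prob_density.
Local Open Scope ereal_scope.
Context (R : realType) (f : R -> R).

Definition prob_density (mf : measurable_fun [set: measurableTypeR R] f)
    (f0 : forall x, (0 <= f x)%R)
    (f1 : \int[lebesgue_measure]_x (f x)%:E = 1) :
  set (measurableTypeR R) -> \bar R := density lebesgue_measure mf f0.

Variables (mf : measurable_fun [set: measurableTypeR R] f).
Variables (f0 : forall x, (0 <= f x)%R).
Variables (f1 : \int[lebesgue_measure]_x (f x)%:E = 1).

HB.instance Definition _ := Measure.on (prob_density mf f0 f1).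

Let prob_density_setT : prob_density mf f0 f1 setT = 1. Proof. exact: f1. Qed.

HB.instance Definition _ := Measure_isProbability.Build _ _ _
  (prob_density mf f0 f1) prob_density_setT.
End prob_density.

Section KL_density.
Local Open Scope ereal_scope.
Context (R : realType) (p q : R -> R).
Hypothesis mp : measurable_fun [set: measurableTypeR R] p.
Hypothesis mq : measurable_fun [set: measurableTypeR R] q.
Hypotheses (p_gt0 : forall x, (0 < p x)%R) (q_gt0 : forall x, (0 < q x)%R).
Hypothesis p1 : \int[lebesgue_measure]_x (p x)%:E = 1.
Hypothesis q1 : \int[lebesgue_measure]_x (q x)%:E = 1.

Let P : distributions R := prob_density mp (fun x => ltW (p_gt0 x)) p1.
Let Q : distributions R := prob_density mq (fun x => ltW (q_gt0 x)) q1.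

Let pq_gt0 x : (0 < p x / q x)%R. Proof. exact: divr_gt0. Qed.

Let mln : measurable_fun [set: measurableTypeR R] (fun x => ln (p x / q x)).
Proof.
rewrite (_ : (fun _ => _) = (fun x => ln (p x) - ln (q x))%R); last first.
  by apply/funext => x; rewrite ln_div// posrE.
by apply: measurable_funB; exact: measurableT_comp.
Qed.

Let mpq : measurable_fun [set: measurableTypeR R] (fun x => p x / q x)%R.
Proof.
rewrite (_ : (fun _ => _) = (fun x => expR (ln (p x / q x)))).
  exact: measurableT_comp.
by apply/funext => x; rewrite lnK// posrE.
Qed.

Let mpqE : measurable_fun [set: measurableTypeR R] (fun x => (p x / q x)%:E).
Proof. exact/measurable_EFinP. Qed.

Let int_pq A : measurable A -> \int[Q]_(x in A) (p x / q x)%:E = P A.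
Proof.
move=> mA; rewrite integral_mkcond ge0_integral_density.
- rewrite [RHS]integral_mkcond; apply: eq_integral => x _.
  rewrite !epatch_indic/= -!EFinM mulrAC divfK//.
  by rewrite gt_eqF.
- exact/(measurable_restrictT _ mA)/measurable_funTS.
- by move=> x; rewrite epatch_indic/= mule_ge0// lee_fin ltW.
Qed.

(** By uniqueness of densities, the Radon-Nikodym derivative is p / q outside of
    a set that is null for Q, hence for P. *)
Lemma KL_density : KL P Q = \int[P]_x (ln (p x / q x))%:E.
Proof.
have PQ : P `<< Q.
  apply/null_content_dominatesP => A mA QA0.
  rewrite -int_pq//; apply: null_set_integral => //.
  exact: measurable_funTS.
rewrite /KL asboolT//; set D := Radon_Nikodym _ _.
have mD : measurable_fun setT D.
  by apply: measurable_int; exact: Radon_Nikodym_integrable.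
have DE : ae_eq Q setT D (fun x => (p x / q x)%:E).
  apply: integral_ae_eq => //; first exact: Radon_Nikodym_integrable.
  by move=> A _ mA; rewrite int_pq// -Radon_Nikodym_integral.
apply: ae_eq_integral => //.
- rewrite (_ : (fun _ => _) =
    (fun x => if D x <= 0 then -oo else (ln (fine (D x)))%:E)); last first.
    apply/funext => x.
    by rewrite -(@fineK _ (D x)) ?Radon_Nikodym_fin_num//= lee_fin.
  apply: measurable_fun_ifT => //; first exact: measurable_fun_lee.
  apply/measurable_EFinP; apply: measurableT_comp => //.
  by apply: measurableT_comp => //; exact: fine_measurable.
- exact/measurable_EFinP.
- apply: null_dominates_ae_eq PQ _ => //.
  apply: filterS DE => x /= + _ => /(_ I) ->.
  by rewrite lne_EFin.
Qed.
End KL_density.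

Section total_variation_distance.
Local Open Scope ereal_scope.
Context (R : realType).
Implicit Types P Q : set (measurableTypeR R) -> \bar R.

Lemma TV_le P Q (alpha : R) : (0 <= alpha)%R ->
  (forall A, measurable A ->
    Q A <= P A + alpha%:E /\ P A <= Q A + alpha%:E) ->
  TV P Q <= alpha%:E.
Proof.
move=> alpha0 PQ; apply/lee_addgt0Pr => e e0; rewrite -EFinD.
apply: ereal_inf_lbound; exists (alpha + e)%R => //; split.
  by rewrite ltr_wpDl.
move=> A mA; have [QP PQA] := PQ A mA; rewrite EFinD.
by rewrite !addeA; split; [apply: (le_trans QP)|apply: (le_trans PQA)];
  rewrite leeDl// lee_fin ltW.
Qed.

(** The infimum need not be attained, so the inequalities hold for alpha + e first
    and then in the limit. *)
Lemma TV_leP P Q (alpha : R) : TV P Q <= alpha%:E ->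
  forall A, measurable A -> P A <= Q A + alpha%:E /\ Q A <= P A + alpha%:E.
Proof.
move=> PQ A mA.
have {}PQ e : (0 < e)%R -> P A <= Q A + (alpha + e)%:E /\ Q A <= P A + (alpha + e)%:E.
  move=> e0; have : TV P Q < (alpha + e)%:E.
    by rewrite (le_lt_trans PQ)// lte_fin ltrDl.
  move=> /ereal_inf_lt[_ [b [b0 /(_ A mA)[QP PQA]] <-]]; rewrite lte_fin => /ltW be.
  by split; [apply: (le_trans PQA)|apply: (le_trans QP)]; rewrite leeD2l.
by split; apply/lee_addgt0Pr => e /PQ[]; rewrite EFinD !addeA.
Qed.
End total_variation_distance.

(** * The likelihood ratio of a log-concave location family *)

Section likelihood_ratio.
Context (R : realType) (g : R -> R) (Delta : R).
Hypothesis g_gt0 : forall x, 0 < g x.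

Lemma lratio_gt0 x : 0 < lratio g Delta x.
Proof. by rewrite /lratio divr_gt0. Qed.

Lemma log_concave_ineq (x y t : R) : log_concave g -> 0 <= t -> t <= 1 ->
  t * ln (g x) + (1 - t) * ln (g y) <= ln (g (t * x + (1 - t) * y)).
Proof.
move=> gc t0 t1; have := gc (Itv01 t0 t1) x y; rewrite !inE => /(_ I I).
rewrite !convRE/= /onem => H.
by rewrite -lerN2 opprD -!mulrN.
Qed.

(** x + Delta and y - Delta lie between x - Delta and y + Delta and have the
    same sum, so concavity compares the two pairs. *)
Lemma lratio_nondecreasing : log_concave g -> 0 <= Delta ->
  {homo lratio g Delta : x y / x <= y}.
Proof.
move=> gc D0 x y; rewrite le_eqVlt => /predU1P[->//|xy].
rewrite -[leLHS]lnK ?posrE ?lratio_gt0// -[leRHS]lnK ?posrE ?lratio_gt0//.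
rewrite ler_expR /lratio !ln_div ?posrE//.
set u := x - Delta; set v := y + Delta.
have d0 : 0 < v - u by rewrite /u /v; lra.
pose t := 2 * Delta / (v - u).
have t0 : 0 <= t by rewrite divr_ge0// ?mulr_ge0// ltW.
have t1 : t <= 1 by rewrite ler_pdivrMr// /u /v; lra.
have tE : t * (v - u) = 2 * Delta by rewrite divfK// gt_eqF.
have Ex : x + Delta = t * v + (1 - t) * u.
  have -> : t * v + (1 - t) * u = t * (v - u) + u by clearbody t u v; ring.
  by rewrite tE /u; ring.
have Ey : y - Delta = t * u + (1 - t) * v.
  have -> : t * u + (1 - t) * v = v - t * (v - u) by clearbody t u v; ring.
  by rewrite tE /v; ring.
rewrite Ex Ey; clearbody t u v.
have := log_concave_ineq v u gc t0 t1.
have := log_concave_ineq u v gc t0 t1.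
lra.
Qed.

End likelihood_ratio.

(** * The Huber function *)

Section huber.
Context (R : realType) (g : R -> R) (Delta c' : R).
Hypothesis g_gt0 : forall x, 0 < g x.
Hypotheses (c'_ge0 : 0 <= c') (c'_le1 : c' <= 1).

Let phi := huber_phi g Delta (- lne c'%:E)%E.

Lemma huber_phi0E x : c' = 0 -> phi x = ln (lratio g Delta x).
Proof.
move=> c0; rewrite /phi /huber_phi c0 le0_lneNy// oppeK.
by rewrite min_r ?leey// max_r ?leNye.
Qed.

Lemma huber_phiE x : 0 < c' ->
  phi x = Num.max (ln c') (Num.min (- ln c') (ln (lratio g Delta x))).
Proof.
by move=> c'0; rewrite /phi /huber_phi lne_EFin// oppeK -EFinN -EFin_min -EFin_max.
Qed.

Lemma huber_phi_nondecreasing : {homo lratio g Delta : x y / x <= y} ->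
  {homo phi : x y / x <= y}.
Proof.
move=> lr x y xy.
have lnxy : ln (lratio g Delta x) <= ln (lratio g Delta y).
  by rewrite ler_ln ?posrE ?lratio_gt0// lr.
have [c'0|c'0|c'0] := ltgtP c' 0; first by move: c'_ge0; rewrite leNgt c'0.
  rewrite !huber_phiE//; apply: le_max2 => //; exact: le_min2.
by rewrite !huber_phi0E.
Qed.

(** Without division, the case c' = 0 needs no convention: both sides hold. *)
Lemma lratio_lt_inve x :
  ((lratio g Delta x)%:E < c'%:E^-1)%E = (c' * g (x - Delta) < g (x + Delta)).
Proof.
rewrite inver; case: eqP => [->|/eqP c'0]; first by rewrite ltry mul0r g_gt0.
have {}c'0 : 0 < c' by rewrite lt0r c'0.
by rewrite lte_fin ltr_pdivrMr// mulrC -ltr_pdivlMl// mulrC ?(mulrC c'^-1).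
Qed.

Lemma lratio_le x :
  (lratio g Delta x <= c') = (g (x - Delta) <= c' * g (x + Delta)).
Proof. by rewrite ler_pdivrMr. Qed.

(** In the three cases, q+ / q- is c', the likelihood ratio and the inverse of
    c'. *)
Lemma phi_star_huber x : phi_star g Delta c' x = 2^-1 * phi x.
Proof.
have l0 := lratio_gt0 Delta g_gt0 x.
have a0 := g_gt0 (x + Delta); have b0 := g_gt0 (x - Delta).
have c1 : 1 + c' != 0 by rewrite gt_eqF// ltr_pwDl.
have s0 : g (x + Delta) + g (x - Delta) != 0 by rewrite gt_eqF// addr_gt0.
rewrite /phi_star /qplus /qminus; congr (_ * _).
have [lc|cl] := leP (lratio g Delta x) c'.
  have c0 : 0 < c' := lt_le_trans l0 lc.
  have lnl : ln (lratio g Delta x) <= ln c' by rewrite ler_ln ?posrE.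
  rewrite huber_phiE// max_l; last by rewrite ge_min lnl orbT.
  congr ln; field.
  by rewrite s0 c1.
have [lV|Vl] := ltP ((lratio g Delta x)%:E) (c'%:E^-1)%E.
  have [c0|c0|c0] := ltgtP c' 0; first by move: c'_ge0; rewrite leNgt c0.
    rewrite huber_phiE//.
    have ln1 : ln c' <= ln (lratio g Delta x) by rewrite ler_ln ?posrE// ltW.
    rewrite min_r ?max_r//.
    rewrite -lnV ?posrE// ler_ln ?posrE ?invr_gt0//.
    by move: lV; rewrite inver gt_eqF// lte_fin => /ltW.
  by rewrite huber_phi0E.
have c0 : 0 < c'.
  rewrite lt0r c'_ge0 andbT; apply: contraTneq Vl => ->.
  by rewrite inve0 -ltNge ltry.
have lnc : ln c' <= 0 by rewrite ln_le0.
rewrite huber_phiE// min_l; last first.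
  rewrite -lnV ?posrE// ler_ln ?posrE ?invr_gt0//.
  by move: Vl; rewrite inver gt_eqF// lee_fin.
rewrite max_r -?lnV ?posrE//; last by rewrite lnV ?posrE//; lra.
congr ln; field.
by rewrite gt_eqF// s0 c1.
Qed.
End huber.

(** * The least favorable densities *)

Section least_favorable_densities.
Context (R : realType) (g : R -> R) (Delta c' : R).
Hypotheses (g_gt0 : forall x, 0 < g x) (g_sym : forall x, g (- x) = g x).
Hypotheses (c'_ge0 : 0 <= c') (c'_le1 : c' <= 1).

Let phi := phi_star g Delta c'.
Let qm := qminus g Delta c'.
Let qp := qplus g Delta c'.

(** The mass that q- removes at x from the nominal density g (x + Delta); by
    symmetry, deficit (- x) is the mass that it adds there. *)
Definition deficit (x : R) : R :=
  Num.max (c' * g (x + Delta) - g (x - Delta)) 0 / (1 + c').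

Let c1_gt0 : 0 < 1 + c'. Proof. by rewrite ltr_pwDl. Qed.

Let gBN x : g (- x - Delta) = g (x + Delta).
Proof. by rewrite -g_sym; congr g; ring. Qed.

Let gDN x : g (- x + Delta) = g (x - Delta).
Proof. by rewrite -g_sym; congr g; ring. Qed.

Lemma deficit_ge0 x : 0 <= deficit x.
Proof. by rewrite divr_ge0 ?le_max ?lexx ?orbT// ltW. Qed.

Lemma qminus_deficit x :
  qm x + deficit x = g (x + Delta) + deficit (- x).
Proof.
rewrite /qm /qminus lratio_lt_inve// lratio_le// /deficit gDN gBN.
have a0 := g_gt0 (x + Delta); have b0 := g_gt0 (x - Delta).
set a := g (x + Delta) in a0 *; set b := g (x - Delta) in b0 *.
have c1 : 1 + c' != 0 by rewrite gt_eqF.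
have [bca|cab] := leP b (c' * a).
  rewrite max_l ?subr_ge0// max_r; first by field.
  have : c' * b <= a; last by lra.
  have := ler_wpM2l c'_ge0 bca; have := ler_wpM2r (ltW a0) c'_le1; nra.
rewrite [in LHS]max_r; last by lra.
have [cba|acb] := ltP (c' * b) a.
  by rewrite max_r; last lra.
by rewrite max_l; [field|lra].
Qed.

Lemma qplusE x : qp x = qm (- x).
Proof.
rewrite /qp /qm /qplus /qminus !lratio_lt_inve// !lratio_le// gDN gBN.
have a0 := g_gt0 (x + Delta); have b0 := g_gt0 (x - Delta).
set a := g (x + Delta) in a0 *; set b := g (x - Delta) in b0 *.
rewrite (addrC b a) !(ltNge (c' * _)).
have [bca|cab] := leP b (c' * a); have [acb|cba] := leP a (c' * b) => //=.
have : c' = 1.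
  apply/eqP; rewrite eq_le c'_le1/= leNgt; apply/negP => c1; nra.
by move=> ->; rewrite mul1r mulrC.
Qed.

Lemma qminus_gt0 x : 0 < qm x.
Proof.
have a0 := g_gt0 (x + Delta); have b0 := g_gt0 (x - Delta).
rewrite /qm /qminus lratio_lt_inve//; case: ifP => [_|_].
  by rewrite divr_gt0// addr_gt0.
have [//|acb] := ltP (c' * g (x - Delta)) (g (x + Delta)).
rewrite mulr_gt0 ?addr_gt0// divr_gt0//.
rewrite lt0r c'_ge0 andbT; apply: contraTneq acb => ->.
by rewrite mul0r -ltNge.
Qed.

Lemma qplus_gt0 x : 0 < qp x. Proof. by rewrite qplusE qminus_gt0. Qed.

Lemma phi_starN x : phi (- x) = - phi x.
Proof.
rewrite /phi /phi_star -[qplus _ _ _ _]/(qp (- x)) -[qminus _ _ _ _]/(qm (- x)).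
rewrite -qplusE qplusE opprK -mulrN -lnV ?posrE ?divr_gt0 ?qplus_gt0 ?qminus_gt0//.
by rewrite invf_div.
Qed.

(** phi is the exponent that tilts q- to the geometric mean of q- and q+. *)
Lemma expR_phi_star x : expR (phi x) * qm x = Num.sqrt (qp x * qm x).
Proof.
have p0 := qplus_gt0 x; have m0 := qminus_gt0 x.
rewrite -[LHS]ger0_norm; last by rewrite mulr_ge0 ?expR_ge0// ltW.
rewrite -sqrtr_sqr; congr Num.sqrt.
rewrite exprMn expr2 -expRD (_ : phi x + phi x = ln (qp x / qm x)); last first.
  by rewrite /phi /phi_star -[qplus _ _ _ _]/(qp x) -[qminus _ _ _ _]/(qm x); field.
rewrite lnK ?posrE ?divr_gt0//.
by rewrite expr2 mulrA divfK// gt_eqF.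
Qed.

(** Mass is removed only where the likelihood ratio is below c', where phi is
    clipped at its minimum. If c' = 0, no mass is removed, and the default value
    of ln c' is harmless. *)
Lemma expR_phi_deficit x : expR (phi x) * deficit x =
  expR (2^-1 * ln c') * deficit x.
Proof.
have [|bca] := leP (c' * g (x + Delta)) (g (x - Delta)) => [cab|].
  by rewrite /deficit max_r ?subr_le0// mul0r !mulr0.
have c0 : 0 < c'.
  rewrite lt0r c'_ge0 andbT; apply: contraTneq bca => ->.
  by rewrite mul0r -leNgt ltW.
rewrite /phi phi_star_huber// huber_phiE// max_l//.
rewrite ge_min ler_ln ?posrE ?lratio_gt0// lratio_le//.
by rewrite (ltW bca) orbT.
Qed.

Lemma phi_star_bound x : 0 < c' ->
  expR (2^-1 * ln c') <= expR (phi x) <= expR (- (2^-1 * ln c')).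
Proof.
move=> c0; have lnc : ln c' <= 0 by rewrite ln_le0.
rewrite !ler_expR /phi phi_star_huber// huber_phiE// -mulrN.
rewrite !ler_pM2l ?invr_gt0// le_max lexx/= ge_max ge_min lexx/= andbT.
lra.
Qed.

Hypothesis mg : measurable_fun [set: measurableTypeR R] g.

Lemma measurable_gB t :
  measurable_fun [set: measurableTypeR R] (fun x => g (x - t)).
Proof. by apply: (measurableT_comp mg); exact: measurable_funB. Qed.

Lemma measurable_deficit : measurable_fun [set: measurableTypeR R] deficit.
Proof.
apply: measurable_funM => //; apply: measurable_maxr => //.
apply: measurable_funB; last exact: measurable_gB.
apply: measurable_funM => //.
by have := measurable_gB (- Delta); under eq_fun do rewrite opprK.
Qed.

Lemma measurable_qminus : measurable_fun [set: measurableTypeR R] qm.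
Proof.
rewrite (_ : qm = fun x => g (x + Delta) + deficit (- x) - deficit x); last first.
  by apply/funext => x; rewrite -qminus_deficit addrK.
apply: measurable_funB; last exact: measurable_deficit.
apply: measurable_funD.
  by have := measurable_gB (- Delta); under eq_fun do rewrite opprK.
by apply: (measurableT_comp measurable_deficit); exact: measurable_funN.
Qed.

Lemma measurable_qplus : measurable_fun [set: measurableTypeR R] qp.
Proof.
rewrite (_ : qp = qm \o -%R); last by apply/funext => x; rewrite /= qplusE.
by apply: (measurableT_comp measurable_qminus); exact: measurable_funN.
Qed.

Lemma measurable_phi_star : measurable_fun [set: measurableTypeR R] phi.
Proof.
rewrite (_ : phi = fun x => 2^-1 * (ln (qp x) - ln (qm x))); last first.
  by apply/funext => x; rewrite -ln_div ?posrE ?qplus_gt0 ?qminus_gt0.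
apply: measurable_funM => //; apply: measurable_funB.
- exact: (measurableT_comp _ measurable_qplus).
- exact: (measurableT_comp _ measurable_qminus).
Qed.

End least_favorable_densities.

(** * Moments of the least favorable pair *)

Section least_favorable_pair.
Local Open Scope ereal_scope.
Context (R : realType) (g : R -> R) (Delta c' alpha : R).
Hypotheses (g_gt0 : forall x, (0 < g x)%R) (g_sym : forall x, g (- x)%R = g x).
Hypothesis g_density : probability_density g.
Hypotheses (c'_ge0 : (0 <= c')%R) (c'_le1 : (c' <= 1)%R).
Hypothesis c'_eq : f_Delta g Delta c' = alpha%:E.

Local Notation mu := (@lebesgue_measure R).
Local Notation phi := (phi_star g Delta c').
Local Notation qm := (qminus g Delta c').
Local Notation qp := (qplus g Delta c').
Local Notation def := (deficit g Delta c').
Local Notation a := (expR (2^-1 * ln c')).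
Local Notation b := (expR (- (2^-1 * ln c'))).

Let mg : measurable_fun [set: measurableTypeR R] g. Proof. by case: g_density. Qed.

Let mgB t := measurable_gB mg t.

Let mgD : measurable_fun [set: measurableTypeR R] (fun x => g (x + Delta))%R.
Proof. by have := mgB (- Delta); under eq_fun do rewrite opprK. Qed.

Let mdef : measurable_fun [set: measurableTypeR R] def.
Proof. exact: measurable_deficit. Qed.

Let mdefN : measurable_fun [set: measurableTypeR R] (fun x => def (- x))%R.
Proof. by apply: (measurableT_comp mdef); exact: measurable_funN. Qed.

Let mqm : measurable_fun [set: measurableTypeR R] qm.
Proof. exact: measurable_qminus. Qed.

Let mqp : measurable_fun [set: measurableTypeR R] qp.
Proof. exact: measurable_qplus. Qed.

Let mphi : measurable_fun [set: measurableTypeR R] phi.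
Proof. exact: measurable_phi_star. Qed.

Let mexp : measurable_fun [set: measurableTypeR R] (fun x => expR (phi x)).
Proof. exact: measurableT_comp. Qed.

Let qm_gt0 x : (0 < qm x)%R. Proof. exact: qminus_gt0. Qed.
Let qp_gt0 x : (0 < qp x)%R. Proof. exact: qplus_gt0. Qed.
Let def_ge0 x : (0 <= def x)%R. Proof. exact: deficit_ge0. Qed.

Lemma integral_location t : \int[mu]_x (g (x - t))%:E = 1.
Proof.
case: g_density => _ g0 <-; rewrite (ge0_integral_lebesgueB (F := EFin \o g))//.
exact/measurable_EFinP.
Qed.

Let integral_gD : \int[mu]_x (g (x + Delta))%:E = 1.
Proof. by have := integral_location (- Delta); under eq_integral do rewrite opprK. Qed.

Lemma integral_deficit : \int[mu]_x (def x)%:E = alpha%:E.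
Proof.
rewrite -c'_eq /f_Delta -ge0_integralZl//.
- by apply: eq_integral => x _; rewrite /deficit -EFinM mulrC.
- apply/measurable_EFinP/measurable_maxr => //; apply: measurable_funB => //.
  exact: measurable_funM.
- by move=> x _; rewrite lee_fin le_max lexx orbT.
- by rewrite lee_fin invr_ge0 addr_ge0.
Qed.

Let integral_deficitN : \int[mu]_x (def (- x))%:E = alpha%:E.
Proof.
rewrite -integral_deficit (ge0_integral_lebesgueN (F := EFin \o def))//.
exact/measurable_EFinP.
Qed.

Lemma alpha_eq0 : c' = 0%R -> alpha = 0%R.
Proof.
move=> c0; apply: EFin_inj; rewrite -integral_deficit; apply: integral0_eq => x _.
by rewrite /deficit c0 mul0r max_r ?mul0r// sub0r oppr_le0 ltW.
Qed.

Lemma integral_qminus : \int[mu]_x (qm x)%:E = 1.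
Proof.
have : \int[mu]_x (qm x)%:E + alpha%:E = 1 + alpha%:E.
  rewrite -{1}integral_deficit -integral_deficitN -integral_gD.
  rewrite -!ge0_integralD//; try (by move=> x _; rewrite lee_fin; first [done | rewrite ltW]);
    try exact/measurable_EFinP.
  by apply: eq_integral => x _; rewrite -!EFinD qminus_deficit.
by move=> /(congr1 (fun z => z - alpha%:E)); rewrite !addeK.
Qed.

Lemma integral_qplus : \int[mu]_x (qp x)%:E = 1.
Proof.
rewrite -integral_qminus -(ge0_integral_lebesgueN (F := EFin \o qm)).
- by apply: eq_integral => x _; rewrite qplusE.
- exact/measurable_EFinP.
- by move=> x; rewrite lee_fin ltW.
Qed.

Let s x := Num.sqrt (qp x * qm x).

Let s_gt0 x : (0 < s x)%R. Proof. by rewrite sqrtr_gt0 mulr_gt0. Qed.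

Let ms : measurable_fun [set: measurableTypeR R] s.
Proof.
rewrite (_ : s = fun x => expR (phi x) * qm x)%R; first exact: measurable_funM.
by apply/funext => x; rewrite expR_phi_star.
Qed.

Let s_le x : (s x <= qp x + qm x)%R.
Proof.
rewrite -(ger0_norm (addr_ge0 (ltW (qp_gt0 x)) (ltW (qm_gt0 x)))) -sqrtr_sqr.
rewrite ler_wsqrtr//.
have := qm_gt0 x; have := qp_gt0 x; nra.
Qed.

Definition affinity : R := fine (\int[mu]_x (Num.sqrt (qp x * qm x))%:E).

Let int_sum : \int[mu]_x (qp x + qm x)%:E = (1 + 1)%:E.
Proof.
rewrite EFinD -{1}integral_qplus -integral_qminus -ge0_integralD//;
  try (by move=> x _; rewrite lee_fin ltW); exact/measurable_EFinP.
Qed.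

Lemma integral_affinity : \int[mu]_x (Num.sqrt (qp x * qm x))%:E = affinity%:E.
Proof.
rewrite fineK// ge0_fin_numE; last first.
  by apply: integral_ge0 => x _; rewrite lee_fin ltW// s_gt0.
apply: (@le_lt_trans _ _ (\int[mu]_x (qp x + qm x)%:E)); last by rewrite int_sum ltry.
apply: ge0_le_integral => //.
- exact/measurable_EFinP.
- exact/measurable_EFinP/measurable_funD.
- by move=> x _; rewrite lee_fin s_le.
Qed.

Lemma affinity_gt0 : (0 < affinity)%R.
Proof.
rewrite lt0r fine_ge0 ?andbT; last first.
  by apply: integral_ge0 => x _; rewrite lee_fin ltW// s_gt0.
apply/eqP => r0; have := integral_affinity; rewrite r0 => int0.
have mqmE : measurable_fun [set: measurableTypeR R] (EFin \o qm).
  exact/measurable_EFinP.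
have ms' : measurable_fun [set: measurableTypeR R] (EFin \o s).
  exact/measurable_EFinP.
have s_ae0 : ae_eq mu setT (EFin \o s) (cst 0).
  apply/(ae_eq_integral_abs mu measurableT ms'); rewrite -[RHS]int0.
  by apply: eq_integral => x _; rewrite gee0_abs// lee_fin ltW// s_gt0.
(* s vanishes nowhere and almost everywhere: every function is then null almost
   everywhere, even the density qm. *)
have : \int[mu]_x (qm x)%:E = \int[mu]_x (cst 0 x).
  apply: ae_eq_integral => //; apply: filterS s_ae0 => x sx0 xT.
  by have := s_gt0 x; rewrite (EFin_inj (sx0 xT)) ltxx.
by rewrite integral_qminus integral0 => /eqP; rewrite onee_eq0.
Qed.

(** Against q-, the integral of expR phi is the affinity. Going back from q- to
    the nominal density takes a mass alpha away from where expR phi is b and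
    puts it back where expR phi is a. *)
Lemma integral_expR_phi_nominal :
  \int[mu]_x (expR (phi x) * g (x + Delta))%:E =
  (affinity - alpha * (b - a))%:E.
Proof.
(* Multiply qminus_deficit by expR (phi x): the removed mass carries the factor
   a, and by oddness of phi the added mass carries the inverse factor b. *)
have balance x : (expR (phi x) * qm x + a * def x =
    expR (phi x) * g (x + Delta) + b * def (- x))%R.
  rewrite -expR_phi_deficit// -mulrDr qminus_deficit// mulrDr; congr (_ + _)%R.
  have := expR_phi_deficit Delta g_gt0 c'_ge0 c'_le1 (- x).
  rewrite phi_starN// => /(congr1 (fun z => b * expR (phi x) * z)%R).
  have := expRxMexpNx_1 (phi x); have := expRxMexpNx_1 (2^-1 * ln c').
  set ea := expR (2^-1 * _); set eb := expR (- (2^-1 * _)).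
  set e := expR (phi x); set e' := expR (- phi x) => ab ee H.
  have : (eb * (e * e') * def (- x) = (ea * eb) * e * def (- x))%R by lra.
  by rewrite ee ab mulr1 mul1r => ->.
have a0 := expR_ge0 (2^-1 * ln c'); have b0 := expR_ge0 (- (2^-1 * ln c')).
have ge0M (k : R) (f : R -> R) : (0 <= k)%R -> (forall x, 0 <= f x)%R ->
    measurable_fun [set: measurableTypeR R] f ->
    \int[mu]_x (f x)%:E = alpha%:E ->
    \int[mu]_x (k * f x)%:E = (k * alpha)%:E.
  move=> k0 f0 mf fE; under eq_integral do rewrite EFinM.
  rewrite ge0_integralZl ?fE//; first exact/measurable_EFinP.
  by move=> x _; rewrite lee_fin.
have : \int[mu]_x (expR (phi x) * g (x + Delta))%:E + (b * alpha)%:E =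
    affinity%:E + (a * alpha)%:E.
  rewrite -(ge0M b _ b0 (fun x => def_ge0 (- x)%R) mdefN integral_deficitN).
  rewrite -(ge0M a _ a0 def_ge0 mdef integral_deficit).
  rewrite -integral_affinity.
  rewrite -!ge0_integralD//;
    try (by move=> x _; rewrite lee_fin ?mulr_ge0// ltW);
    try (by move=> x _; rewrite lee_fin mulr_ge0);
    try (apply/measurable_EFinP; first [exact: ms | exact: measurable_funM]).
  by apply: eq_integral => x _; rewrite -!EFinD -expR_phi_star// balance.
move=> /(congr1 (fun z => z - (b * alpha)%:E)); rewrite addeK// => ->.
by rewrite -!EFinD; congr (_%:E); ring.
Qed.

(** H is distributed under the law of parameter theta as expR phi is under the
    nominal law. Its expectation there falls short of the affinity by
    alpha * (b - a), which is the most that a perturbation of size alpha can add. If c' = 0 there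
    is no upper bound b, but alpha = 0 and the perturbation is trivial. *)
Let moment_le_affinity (P : distributions R) (theta : R) (H : R -> R) :
  TV P (location g theta) <= alpha%:E ->
  measurable_fun [set: measurableTypeR R] H -> (forall x, (0 <= H x)%R) ->
  (forall x, (0 < c')%R -> (a <= H x <= b)%R) ->
  \int[mu]_x (H x * g (x - theta))%:E =
    \int[mu]_x (expR (phi x) * g (x + Delta))%:E ->
  \int[P]_x (H x)%:E <= affinity%:E.
Proof.
move=> PL mH H0 Hab HE.
pose L : distributions R := prob_density (mgB theta)
  (fun x => ltW (g_gt0 (x - theta))) (integral_location theta).
have LH : \int[L]_x (H x)%:E = (affinity - alpha * (b - a))%:E.
  rewrite ge0_integral_density//; last exact/measurable_EFinP.
  by rewrite -integral_expR_phi_nominal -HE.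
have alpha_ge0 : (0 <= alpha)%R.
  by rewrite -lee_fin -integral_deficit; apply: integral_ge0 => x _; rewrite lee_fin.
have {}PL := TV_leP PL; move: c'_ge0; rewrite le_eqVlt => /predU1P[c0|c0].
  have alpha0 : alpha = 0%R by exact: alpha_eq0.
  rewrite (_ : \int[P]_x (H x)%:E = \int[L]_x (H x)%:E).
    by rewrite LH alpha0 mul0r subr0.
  apply: eq_measure_integral => A mA _; apply/eqP; rewrite eq_le.
  by have [] := PL A mA; rewrite alpha0 !adde0 => -> ->.
have := @le_integral_total_variation _ _ _ P L H a b alpha mH (expR_ge0 _)
  (Hab^~ c0) alpha_ge0 (fun A mA => (PL A mA).1).
by rewrite LH -EFinD subrK.
Qed.

Lemma moment_phi_star_right (P : distributions R) (theta : R) :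
  TV P (location g theta) <= alpha%:E ->
  \int[P]_x (expR (phi (x - (theta + Delta))))%:E <= affinity%:E.
Proof.
move=> PL; apply: (moment_le_affinity PL) => //.
- by apply: (measurableT_comp mexp); exact: measurable_funB.
- by move=> x; exact: phi_star_bound.
- rewrite -(ge0_integral_lebesgueB (F := fun x =>
    (expR (phi x) * g (x + Delta))%:E) (theta + Delta)).
  + by apply: eq_integral => x _; rewrite opprD addrA subrK.
  + exact/measurable_EFinP/measurable_funM.
  + by move=> x; rewrite lee_fin mulr_ge0// ltW.
Qed.

Lemma moment_phi_star_left (P : distributions R) (theta : R) :
  TV P (location g theta) <= alpha%:E ->
  \int[P]_x (expR (- phi (x - (theta - Delta))))%:E <= affinity%:E.
Proof.
move=> PL; have phiN x : (- phi (x - (theta - Delta)) = phi (theta - Delta - x))%R.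
  by rewrite -phi_starN// opprB.
under eq_integral do rewrite phiN.
apply: (moment_le_affinity PL) => //.
- by apply: (measurableT_comp mexp); exact: measurable_funB.
- by move=> x; exact: phi_star_bound.
(* The integrand of the nominal law, reflected and then translated. *)
- pose F x := (expR (phi (- x)) * g (- x + Delta))%:E.
  have mF : measurable_fun [set: measurableTypeR R] F.
    apply/measurable_EFinP/measurable_funM.
    + by apply: (measurableT_comp mexp); exact: measurable_funN.
    + by apply: (measurableT_comp mgD); exact: measurable_funN.
  have F0 x : 0 <= F x by rewrite lee_fin mulr_ge0// ltW.
  transitivity (\int[mu]_x F (x - (theta - Delta))%R).
    apply: eq_integral => x _; rewrite /F opprB -[in LHS]g_sym.
    by congr (_ * g _)%:E; ring.
  rewrite ge0_integral_lebesgueB// -[LHS]ge0_integral_lebesgueN//.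
  by apply: eq_integral => x _; rewrite /F opprK.
Qed.

(** * The law halfway between the least favorable pair *)

Section tilted_law.

Let p x := (s x / affinity)%R.

Let sN x : s (- x) = s x.
Proof. by rewrite /s !qplusE// opprK mulrC. Qed.

Let p_gt0 x : (0 < p x)%R. Proof. by rewrite divr_gt0// affinity_gt0. Qed.

Let mp : measurable_fun [set: measurableTypeR R] p.
Proof. exact: measurable_funM. Qed.

Let p1 : \int[mu]_x (p x)%:E = 1.
Proof.
under eq_integral do rewrite EFinM.
rewrite ge0_integralZr//.
- by rewrite integral_affinity -EFinM divff// gt_eqF// affinity_gt0.
- exact/measurable_EFinP.
- by move=> x _; rewrite lee_fin ltW// s_gt0.
- by rewrite lee_fin invr_ge0 ltW// affinity_gt0.
Qed.

Let P : distributions R := prob_density mp (fun x => ltW (p_gt0 x)) p1.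
Let Qm : distributions R :=
  prob_density mqm (fun x => ltW (qm_gt0 x)) integral_qminus.
Let Qp : distributions R :=
  prob_density mqp (fun x => ltW (qp_gt0 x)) integral_qplus.

(** With t = expR (- |phi x|) in ]0, 1], the larger of the two densities times
    t is s x, and - t ln t is at most 1. *)
Let phi_s_le x : (`|phi x| * s x <= qp x + qm x)%R.
Proof.
have bound z : (0 <= phi z -> phi z * s z <= qp z)%R.
  move=> pz0.
  have <- : (expR (phi z) * s z = qp z)%R.
    have sz := expR_phi_star Delta g_gt0 g_sym c'_ge0 c'_le1 z.
    have s2 : (s z * s z = qp z * qm z)%R.
      by rewrite -expr2 sqr_sqrtr// mulr_ge0// ltW.
    apply: (mulIf (negbT (gt_eqF (qm_gt0 z)))).
    by rewrite -s2 mulrAC sz.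
  by rewrite ler_pM2r// (le_trans _ (expR_ge1Dx _))// lerDr.
have [p0|p0] := ger0P (phi x).
  by have := bound x p0; have := qm_gt0 x; lra.
have := bound (- x)%R; rewrite phi_starN// sN qplusE// opprK oppr_ge0.
by move=> /(_ (ltW p0)); have := qp_gt0 x; lra.
Qed.

Let integrable_phi : P.-integrable setT (EFin \o phi).
Proof.
apply/integrableP; split; first exact/measurable_EFinP.
have mabs : measurable_fun [set: measurableTypeR R] (fun x => `|(phi x)%:E|).
  by apply: measurableT_comp => //; exact/measurable_EFinP.
rewrite ge0_integral_density//.
apply: (@le_lt_trans _ _ (\int[mu]_x ((affinity^-1)%:E * (qp x + qm x)%:E))).
  apply: ge0_le_integral => //.
  - by move=> x _; rewrite mule_ge0// lee_fin ltW.
  - by apply: emeasurable_funM => //; exact/measurable_EFinP.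
  - by apply: emeasurable_funM => //; exact/measurable_EFinP/measurable_funD.
  - move=> x _; rewrite -!EFinM lee_fin /p mulrA mulrC.
    by rewrite ler_wpM2l ?phi_s_le// invr_ge0 ltW// affinity_gt0.
rewrite ge0_integralZl//.
- by rewrite int_sum -EFinM ltry.
- exact/measurable_EFinP/measurable_funD.
- by move=> x _; rewrite lee_fin addr_ge0// ltW.
- by rewrite lee_fin invr_ge0 ltW// affinity_gt0.
Qed.

(** phi is odd and P is symmetric. *)
Let integral_phi : \int[P]_x (phi x)%:E = 0.
Proof.
have mN : measurable_fun [set: measurableTypeR R]
  (-%R : _ -> measurableTypeR R) by exact: measurable_funN.
have mphiE : measurable_fun [set: measurableTypeR R] (EFin \o phi).
  exact/measurable_EFinP.
have phiN : (EFin \o phi) \o -%R = (fun x => - (phi x)%:E).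
  by apply/funext => x /=; rewrite phi_starN.
have : \int[P]_x (phi x)%:E = - \int[P]_x (phi x)%:E.
  transitivity (\int[pushforward P (-%R : _ -> measurableTypeR R)]_x (phi x)%:E).
    apply: eq_measure_integral => A mA _; rewrite /pushforward.
    have mpA : measurable_fun [set: measurableTypeR R] ((EFin \o p) \_ A).
      apply/(measurable_restrictT _ mA)/measurable_funTS.
      exact/measurable_EFinP.
    rewrite [LHS]integral_mkcond [RHS]integral_mkcond.
    rewrite -[LHS]ge0_integral_lebesgueN//; last first.
      by move=> x; apply: erestrict_ge0 => y _; rewrite lee_fin ltW.
    apply: eq_integral => x _; rewrite !epatch_indic/= /p sN.
    by congr (_ * _); rewrite !indicE !inE.
  rewrite (integral_pushforward mN mphiE) ?preimage_setT// phiN.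
    by rewrite integralN// integrable_add_def.
  exact: integrableN.
by case: (\int[P]_x (phi x)%:E) (integrable_fin_num measurableT integrable_phi)
  => //= r _ [r_eq]; congr (_%:E); lra.
Qed.

(** The density of P is at the geometric middle of q- and q+: the two log ratios
    are - ln affinity plus or minus phi, which has mean zero. *)
Lemma KL_tilted : KL P Qm = (- ln affinity)%:E /\ KL P Qp = (- ln affinity)%:E.
Proof.
have aff0 := affinity_gt0.
have lnpm x : (ln (p x / qm x) = phi x - ln affinity)%R.
  rewrite /p /s -expR_phi_star// mulrAC mulfK ?gt_eqF// ln_div ?posrE ?expR_gt0//.
  by rewrite expRK.
have lnpp x : (ln (p x / qp x) = - phi x - ln affinity)%R.
  by rewrite -phi_starN// -lnpm qplusE// /p sN.
have icst : P.-integrable setT (EFin \o (cst (ln affinity) : R -> R)).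
  exact: finite_measure_integrable_cst.
have int_cst : \int[P]_x (ln affinity)%:E = (ln affinity)%:E.
  transitivity ((ln affinity)%:E * P setT); first exact: integral_cst.
  by rewrite probability_setT mule1.
split; rewrite KL_density.
- under eq_integral do rewrite lnpm EFinB.
  by rewrite integralB// integral_phi int_cst sub0e.
- under eq_integral do rewrite lnpp EFinB EFinN.
  rewrite integralB//; last exact: integrableN.
  rewrite integralN ?integral_phi ?int_cst ?oppe0 ?sub0e//.
  exact: integrable_add_def.
Qed.

(** From a nominal density to the least favorable one, the removed mass and the
    added mass are both alpha, and each controls one of the two inequalities. *)
Lemma TV_least_favorable :
  TV Qm (location g (- Delta)) <= alpha%:E /\ TV Qp (location g Delta) <= alpha%:E.
Proof.
have alpha_ge0 : (0 <= alpha)%R.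
  by rewrite -lee_fin -integral_deficit; apply: integral_ge0 => x _; rewrite lee_fin.
have le_int A (u v w : R -> R) : measurable A ->
    measurable_fun [set: measurableTypeR R] u ->
    measurable_fun [set: measurableTypeR R] v ->
    measurable_fun [set: measurableTypeR R] w ->
    (forall x, 0 <= u x)%R -> (forall x, 0 <= v x)%R -> (forall x, 0 <= w x)%R ->
    (forall x, u x <= v x + w x)%R -> \int[mu]_x (w x)%:E = alpha%:E ->
    \int[mu]_(x in A) (u x)%:E <= \int[mu]_(x in A) (v x)%:E + alpha%:E.
  move=> mA mu' mv mw u0 v0 w0 uvw <-.
  have mE f : measurable_fun [set: measurableTypeR R] f ->
      measurable_fun A (fun x => (f x)%:E).
    by move=> mf; apply/measurable_EFinP/measurable_funTS.
  apply: (@le_trans _ _ (\int[mu]_(x in A) ((v x)%:E + (w x)%:E))).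
    apply: ge0_le_integral => //.
    - by move=> x _; rewrite lee_fin.
    - exact: mE.
    - by apply: emeasurable_funD; exact: mE.
    - by move=> x _; rewrite -EFinD lee_fin.
  rewrite ge0_integralD//; [|by move=> x _; rewrite lee_fin|exact: mE|
    by move=> x _; rewrite lee_fin|exact: mE].
  rewrite leeD2l//; apply: ge0_subset_integral => //; first exact/measurable_EFinP.
  by move=> x _; rewrite lee_fin.
have bal x := qminus_deficit Delta g_gt0 g_sym c'_ge0 c'_le1 x.
have d0 := def_ge0; have dN0 x := def_ge0 (- x)%R.
have gm0 t x := ltW (g_gt0 (x - t)%R).
have qm0 x := ltW (qm_gt0 x); have qp0 x := ltW (qp_gt0 x).
have balm x : (qm x + def x = g (x - - Delta) + def (- x))%R.
  by rewrite opprK bal.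
have balp x : (qp x + def (- x) = g (x - Delta) + def x)%R.
  rewrite qplusE// bal opprK; congr (_ + _)%R.
  by rewrite -g_sym; congr g; ring.
pose defN x := def (- x).
split; apply: TV_le => // A mA; split;
  [apply: (le_int _ _ _ def)|apply: (le_int _ _ _ defN)|
   apply: (le_int _ _ _ defN)|apply: (le_int _ _ _ def)] => //;
  try exact: integral_deficit.
all: move=> x; rewrite /defN; have := balm x; have := balp x.
all: have := d0 x; have := dN0 x; lra.
Qed.

(** P is within r of both least favorable laws, so that - Delta and Delta belong
    to its robust set, which is not covered by an interval of radius less than
    Delta. *)
Lemma le_Delta_wc (r : R) : (- ln affinity <= r)%R ->
  Delta%:E <= Delta_wc g r alpha.
Proof.
move=> ar; have [KLm KLp] := KL_tilted; have [TVm TVp] := TV_least_favorable.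
have dro_m : dro_set g r alpha P (- Delta)%R by exists Qm; rewrite KLm lee_fin.
have dro_p : dro_set g r alpha P Delta by exists Qp; rewrite KLp lee_fin.
apply: (@le_trans _ _ (set_radius (dro_set g r alpha P))); last first.
  by apply: ereal_sup_ubound; exists P.
rewrite /set_radius asboolF; last by move=> dro0; rewrite dro0 in dro_p.
apply: le_ereal_inf_tmp => _ [t _ <-]; have [t0|t0] := leP t 0%R.
- apply: (@le_trans _ _ (`|t - Delta|%R)%:E).
    by rewrite lee_fin -normrN opprB (le_trans _ (ler_norm _))// lerDl oppr_ge0.
  by apply: ereal_sup_ubound; exists Delta.
- apply: (@le_trans _ _ (`|t - - Delta|%R)%:E).
    by rewrite lee_fin opprK (le_trans _ (ler_norm _))// lerDr ltW.
  by apply: ereal_sup_ubound; exists (- Delta)%R.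
Qed.

End tilted_law.
End least_favorable_pair.

(** * Estimating equations *)

Section phi_estimators.
Context (R : realType).
Implicit Types (phi : R -> R) (E : distributions R -> R).

Lemma phi_admissible_integrable phi (P : distributions R) (t : R) :
  measurable_fun [set: measurableTypeR R] phi -> phi_admissible phi P ->
  P.-integrable [set: measurableTypeR R] (fun x => (phi (x - t))%:E).
Proof.
move=> mphi [[M phiM]|]; last exact.
have mt : measurable_fun [set: measurableTypeR R] (fun x => phi (x - t)).
  by apply: (measurableT_comp mphi); exact: measurable_funB.
apply: (@le_integrable _ _ _ P _ measurableT _ (EFin \o cst M)).
- exact/measurable_EFinP.
- by move=> x _; rewrite lee_fin (le_trans (phiM _))// ler_norm.
- exact: finite_measure_integrable_cst.
Qed.

Lemma phi_estimatorZ phi (k : R) E : k != 0 ->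
  measurable_fun [set: measurableTypeR R] phi ->
  phi_estimator phi E -> phi_estimator (fun x => k * phi x) E.
Proof.
move=> k0 mphi Ephi P Padm.
have {}Padm : phi_admissible phi P.
  case: Padm => [[M phiM]|Pint]; [left|right].
    exists (`|k|^-1 * M) => x; rewrite ler_pdivlMl ?normr_gt0//.
    by rewrite -normrM.
  move=> t; have := integrableZl measurableT k^-1 (Pint t).
  apply: eq_integrable => // x _.
  by rewrite -EFinM mulKf.
under eq_integral do rewrite EFinM.
rewrite integralZl//; last exact: phi_admissible_integrable.
by rewrite Ephi// mule0.
Qed.

(** Whatever phi is, an empirical distribution is admissible, as it integrates
    every measurable function. *)
Lemma phi_estimator_empirical phi E (x : nat -> R) (n : nat) :
  measurable_fun [set: measurableTypeR R] phi -> phi_estimator phi E ->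
  \sum_(i < n.+1) phi (x i - E (empirical x n)) = 0.
Proof.
move=> mphi Ephi; have mt t :
    measurable_fun [set: measurableTypeR R] (fun y => phi (y - t)).
  by apply: (measurableT_comp mphi); exact: measurable_funB.
have := Ephi (empirical x n) (or_intror (fun t => integrable_empirical x n (mt t))).
rewrite integral_empirical// => -[] /eqP.
by rewrite mulf_eq0 invr_eq0 pnatr_eq0/= => /eqP.
Qed.
End phi_estimators.

(** * Coincidence with the Huber estimator and error exponent *)

Theorem theorem3p8 (R : realType) (g : R -> R)
    (g_gt0 : forall x, 0 < g x)
    (g_density : probability_density g)
    (g_log_concave : log_concave g)
    (g_sym : forall x, g (- x) = g x)
    (alpha Delta c' : R)
    (alpha_ge0 : 0 <= alpha) (alpha_le : alpha <= 2^-1)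
    (Delta_ge0 : 0 <= Delta)
    (c'_ge0 : 0 <= c') (c'_le1 : c' <= 1)
    (c'_eq : f_Delta g Delta c' = alpha%:E) :
  (forall E : distributions R -> R,
      phi_estimator (phi_star g Delta c') E <->
      phi_estimator (huber_phi g Delta (- lne c'%:E)%E) E) /\
  (forall E : distributions R -> R,
      phi_estimator (phi_star g Delta c') E ->
    forall r : R, 0 < r -> (Delta_wc g r alpha < Delta%:E)%E ->
    forall (thetas : R) (Pc : distributions R),
      (TV Pc (location g thetas) <= alpha%:E)%E ->
    forall (d : measure_display) (Omega : measurableType d)
        (Pr : probability Omega R) (X : nat -> {RV Pr >-> measurableTypeR R}),
      iid X Pc ->
    let event n :=
      [set w : Omega |
        Delta < `|E (empirical (fun i => X i w) n) - thetas|] in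
      (forall n, measurable (event n)) ->
      (limn_esup (fun n => (n.+1%:R^-1)%:E * lne (Pr (event n))) < (- r)%:E)%E).
Proof.
have mg : measurable_fun [set: measurableTypeR R] g by case: g_density.
have phiE := phi_star_huber Delta g_gt0 c'_ge0 c'_le1.
have phi_nd : {homo phi_star g Delta c' : x y / x <= y}.
  move=> x y xy; rewrite !phiE ler_pM2l ?invr_gt0//.
  by apply: huber_phi_nondecreasing => //; exact: lratio_nondecreasing.
have mphi : measurable_fun [set: measurableTypeR R] (phi_star g Delta c').
  exact: measurable_phi_star.
split=> [E|E Ephi r r0 rad thetas Pc TVP d Omega Pr X X_iid event mevent].
  have huberE : huber_phi g Delta (- lne c'%:E)%E = fun x => 2 * phi_star g Delta c' x.
    by apply/funext => x; rewrite phiE mulVKf.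
  have phiE' : phi_star g Delta c' = fun x => 2^-1 * huber_phi g Delta (- lne c'%:E)%E x.
    exact/funext.
  split=> [Ephi|Ehub].
    by rewrite huberE; apply: phi_estimatorZ.
  rewrite phiE'; apply: phi_estimatorZ => //.
  by rewrite huberE; exact: measurable_funM.
set rho := affinity g Delta c'.
have rho0 : 0 < rho by exact: (affinity_gt0 _ _ _ _ _ c'_eq).
have rho_r : ln rho < - r.
  rewrite ltrNr ltNge; apply/negP => rho_r.
  by move: rad; rewrite ltNge (le_Delta_wc _ _ _ _ _ c'_eq).
apply: (@le_lt_trans _ _ (ln rho)%:E); last by rewrite lte_fin.
apply: (@limn_esup_rate_le _ _ 2) => // n; rewrite measure_ge0/=.
pose psi1 x := phi_star g Delta c' (x - (thetas + Delta)).
pose psi2 x := - phi_star g Delta c' (x - (thetas - Delta)).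
have mpsi1 : measurable_fun [set: measurableTypeR R] psi1.
  by apply: (measurableT_comp mphi); exact: measurable_funB.
have mpsi2 : measurable_fun [set: measurableTypeR R] psi2.
  apply: measurableT_comp => //.
  by apply: (measurableT_comp mphi); exact: measurable_funB.
pose A (psi : R -> R) := [set w | 0 <= \sum_(0 <= i < n.+1) psi (X i w)].
have mA psi : measurable_fun [set: measurableTypeR R] psi -> measurable (A psi).
  exact: measurable_sum_ge0.
have chern psi : measurable_fun [set: measurableTypeR R] psi ->
    (\int[Pc]_x (expR (psi x))%:E <= rho%:E)%E ->
    (Pr (A psi) <= (rho ^+ n.+1)%:E)%E.
  exact: (chernoff_iid n.+1 X_iid).
have sub : event n `<=` A psi1 `|` A psi2.
  move=> w; rewrite /event/=; set e := E _ => we.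
  have sum0 := phi_estimator_empirical (fun i => X i w) n mphi Ephi.
  have : thetas + Delta < e \/ e < thetas - Delta.
    by move: we; rewrite ltr_normr => /orP[]; [left|right]; lra.
  case=> eD; [left|right]; rewrite /A/= big_mkord.
  - rewrite -[leLHS]sum0; apply: ler_sum => i _; apply: phi_nd.
    by rewrite lerD2l lerN2 ltW.
  - rewrite sumrN oppr_ge0 -[leRHS]sum0; apply: ler_sum => i _; apply: phi_nd.
    by rewrite lerD2l lerN2 ltW.
apply: (@le_trans _ _ (Pr (A psi1) + Pr (A psi2))%E).
  apply: le_trans (measureU2 _ _ _); [|exact: mA..].
  by apply: le_measure => //; rewrite inE//; apply: measurableU; exact: mA.
rewrite mulrDl mul1r EFinD; apply: leeD; apply: chern => //.
- exact: (moment_phi_star_right g_gt0 g_sym g_density c'_ge0 c'_le1 c'_eq TVP).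
- exact: (moment_phi_star_left g_gt0 g_sym g_density c'_ge0 c'_le1 c'_eq TVP).
Qed.
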